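(* Let $m,n$ be positive integers, let $\Theta$ be a real $n\times m$ matrix that is not trivially singular, let $\varepsilon>0$, and let $h$ be a positive non-increasing function on $\mathbb{R}_+$. (a) If $\Theta$ is not $F$-approximable, where $F(T)=(1+\varepsilon)2^n h\!\left(\frac{T}{2^m}\right)$, then there is no $\pmb\eta\in\widehat{\mathbf D}^{\Theta}_{n,m}[h]$ such that the pair $(\Theta,\pmb\eta)$ is not trivially singular. (b) Let $A=3^{n+m}-1$ and $B=2^{m-1}(2^{2n}-2^n)$. If $\Theta$ is $F$-approximable, where $F(T)=\frac{1-\varepsilon}{2^nB^n}\,h\!\left(2^mA^mT\right)$, then the set $\widehat{\mathbf D}^{\Theta}_{n,m}[h]$ is uncountable.
   Context: $|\cdot|$ is the supremum norm; $\|\mathbf v\|_{\mathbb{Z}^n}=\min_{\mathbf p\in\mathbb{Z}^n}|\mathbf v-\mathbf p|$. $\Theta$ is trivially singular if $\Theta\mathbf q\in\mathbb{Z}^n$ for some nonzero $\mathbf q\in\mathbb{Z}^m$. The pair $(\Theta,\pmb\eta)$ is trivially singular if $\Theta\mathbf q-\pmb\eta\in\mathbb{Z}^n$ for some $\mathbf q\in\mathbb{Z}^m$. $\Theta$ is $F$-approximable if $\|\Theta\mathbf q\|_{\mathbb{Z}^n}^n\le F(|\mathbf q|^m)$ for infinitely many $\mathbf q\in\mathbb{Z}^m\setminus\{\mathbf 0\}$. $\widehat{\mathbf D}^{\Theta}_{n,m}[h]$ is the set of $\pmb\eta\in\mathbb{R}^n$ such that for all sufficiently large $T$ there is a nonzero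 $\mathbf q\in\mathbb{Z}^m$ with $\|\Theta\mathbf q-\pmb\eta\|_{\mathbb{Z}^n}^n\le h(T)$ and $|\mathbf q|^m\le T$. *)

(* Defs.v *)
From mathcomp Require Import all_boot all_order all_algebra.
From mathcomp Require Import all_classical all_reals all_analysis.
From mathcomp Require Import lra.
Set Implicit Arguments.
Unset Strict Implicit.
Unset Printing Implicit Defensive.
Import Order.TTheory GRing.Theory Num.Theory.
Import numFieldNormedType.Exports.
Local Open Scope classical_set_scope.
Local Open Scope ring_scope.

(* On matrices over a realType, [`|v|] is the supremum norm [mx_norm]. *)

Definition intv {R : realType} {k : nat} (q : 'cV[int]_k) : 'cV[R]_k :=
  map_mx intr q.

(* The infimum is a minimum: see [distZ_min]. *)
Definition distZ {R : realType} {n : nat} (v : 'cV[R]_n) : R :=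
  inf [set `|v - intv p| | p in [set: 'cV[int]_n]].

Lemma distZ_min {R : realType} {n : nat} (v : 'cV[R]_n) :
  (exists p : 'cV[int]_n, distZ v = `|v - intv p|) /\
  (forall p : 'cV[int]_n, distZ v <= `|v - intv p|).
Proof.
pose E := [set `|v - intv p| | p in [set: 'cV[int]_n]].
have lbE : has_lbound E by exists 0 => _ [p _ <-].
have inE (p : 'cV[int]_n) : E `|v - intv p| by exists p.
split; last by move=> p; exact: ge_inf.
pose p0 : 'cV[int]_n := \col_i Num.floor (v i ord0 + 2^-1).
have near (x : R) (z : int) : `|x - (Num.floor (x + 2^-1))%:~R| <= `|x - z%:~R|.
  have /andP[] := floor_itv (x + 2^-1).
  set f := Num.floor _; rewrite intrD => fx xf.
  have [->//|zf] := eqVneq z f.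
  have d1 : `|x - f%:~R| <= 2^-1 by rewrite ler_norml; apply/andP; split; lra.
  have d2 : (1 : R) <= `|f%:~R - z%:~R|.
    by rewrite -intrB -intr_norm (ler_int _ 1) -gtz0_ge1 normr_gt0 subr_eq0 eq_sym.
  have := ler_distD x f%:~R z%:~R; rewrite (distrC f%:~R x); lra.
exists p0; apply/eqP; rewrite eq_le ge_inf /=; [|exact: lbE|exact: inE].
apply: lb_le_inf; first by exists `|v - intv p0|.
move=> _ [p _ <-].
rewrite [leLHS]/Num.Def.normr/= mx_normrE; apply: bigmax_le => // -[i j] _.
rewrite (ord1 j) !mxE /=; apply: (le_trans (near _ (p i ord0))).
rewrite [leRHS]/Num.Def.normr/= mx_normrE; apply/bigmax_geP; right => /=.
by exists (i, ord0); rewrite // !mxE.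
Qed.

Definition trivially_singular {R : realType} {n m : nat} (Theta : 'M[R]_(n, m)) :
    Prop :=
  exists2 q : 'cV[int]_m, q != 0 &
    exists p : 'cV[int]_n, Theta *m intv q = intv p.

(* Here [q = 0] is allowed. *)
Definition trivially_singular_pair {R : realType} {n m : nat}
    (Theta : 'M[R]_(n, m)) (eta : 'cV[R]_n) : Prop :=
  exists (q : 'cV[int]_m) (p : 'cV[int]_n), Theta *m intv q - eta = intv p.

Definition approximable {R : realType} {n m : nat} (F : R -> R)
    (Theta : 'M[R]_(n, m)) : Prop :=
  infinite_set [set q : 'cV[int]_m |
    q != 0 /\ distZ (Theta *m intv q) ^+ n <= F (`|intv q : 'cV[R]_m| ^+ m)].

Definition hatD {R : realType} {n m : nat} (Theta : 'M[R]_(n, m)) (h : R -> R) :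
    set 'cV[R]_n :=
  [set eta | \forall T \near +oo, exists q : 'cV[int]_m,
    [/\ q != 0,
        distZ (Theta *m intv q - eta) ^+ n <= h T &
        `|intv q : 'cV[R]_m| ^+ m <= T]].

(* Main.v *)
Require Import Defs.
From mathcomp Require Import all_boot all_order all_algebra.
From mathcomp Require Import all_classical all_reals all_analysis.
From mathcomp Require Import lra zify.
Import Order.TTheory GRing.Theory Num.Theory.
Import numFieldNormedType.Exports.
Local Open Scope classical_set_scope.
Local Open Scope ring_scope.

(** Part (a): suppose [eta] is uniformly approximated with rate [h] but never
    hit. Choose a small [c] and let [N] be the least norm at which some nonzero
    [q'] satisfies [distZ (Theta *m intv q' - eta) < c]. For the parameter
    [T = (N - 1/2) ^+ m], just before [q'] appears, uniform approximation yields
    some [q] of norm at most [N - 1]; by minimality it is farther from [eta]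
    than [q']. Hence [q - q'] is nonzero of norm at most [2N - 1], and its image
    is within twice the distance of [q], that is within [2 h(T)^(1/n)], of the
    integers: it satisfies the inequality defining approximability. Letting
    [c] tend to [0] makes [N] grow, so that these distances tend to [0]; as
    [Theta] is not trivially singular, each [q - q'] can occur only finitely
    often in this process, and there are infinitely many ([small_of_hatD],
    [approximable_of_small]). This needs [h] to tend to [0]; if [h] is bounded
    below, Dirichlet's pigeonhole provides the solutions ([dirichlet_pow]).

    Part (b): let [v = Theta *m intv q - intv p] run through the errors of very
    good approximations [q], each much longer than the preceding ones. A series
    of terms [j *: v], with [j] equal to [1] or [2], converges to some [eta];
    its partial sums have the form [Theta *m intv Q - intv P], and the distance
    from [eta] to a partial sum is dominated by the next error, which is small
    compared with [h] at the size of the next [Q]. So [eta] is in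
    [hatD Theta h]. The free choice of [j] at each step makes Cantor's diagonal
    argument possible: the series can be steered away from any given sequence of
    points ([ball_refinement], [hatD_uncountable]). The constants [A] and [B]
    enter only through [A >= 8] and [B >= 2], which leave room for the crude
    bounds [3 * distZ] and [3 * norm] used along the series. *)

(** * Norms of integer vectors and distance to the integers *)

Lemma le_cV_norm {R : realType} {k : nat} (v : 'cV[R]_k) (i : 'I_k) :
  `|v i ord0| <= `|v|.
Proof.
rewrite [leRHS]/Num.Def.normr/= mx_normrE; apply/bigmax_geP; right => /=.
by exists (i, ord0).
Qed.

Lemma cV_norm_le {R : realType} {k : nat} (v : 'cV[R]_k) (c : R) :
  0 <= c -> (forall i, `|v i ord0| <= c) -> `|v| <= c.
Proof.
move=> c0 vc; rewrite [leLHS]/Num.Def.normr/= mx_normrE.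
by apply: bigmax_le => // -[i j] _; rewrite (ord1 j); exact: vc.
Qed.

Lemma intvD {R : realType} {k : nat} (p q : 'cV[int]_k) :
  intv (p + q) = intv p + intv q :> 'cV[R]_k.
Proof. exact: map_mxD. Qed.

Lemma intvB {R : realType} {k : nat} (p q : 'cV[int]_k) :
  intv (p - q) = intv p - intv q :> 'cV[R]_k.
Proof. exact: map_mxB. Qed.

Lemma intvMn {R : realType} {k : nat} (p : 'cV[int]_k) (j : nat) :
  intv (p *+ j) = intv p *+ j :> 'cV[R]_k.
Proof. exact: raddfMn. Qed.

Lemma intv0 {R : realType} {k : nat} : intv 0 = 0 :> 'cV[R]_k.
Proof. exact: map_mx0. Qed.

Lemma intv_norm_nat {R : realType} {k : nat} (q : 'cV[int]_k) :
  exists N : nat, `|intv q : 'cV[R]_k| = N%:R.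
Proof.
rewrite /Num.Def.normr/= mx_normrE.
elim/big_ind: _ => [|_ _ [a ->] [b ->]|[i j] _]; first by exists 0%N.
  by exists (maxn a b); rewrite natr_max.
by exists `|q i j|%N; rewrite mxE /= -intr_norm -abszE.
Qed.

Lemma intv_norm_gt0 {R : realType} {k : nat} (q : 'cV[int]_k) :
  q != 0 -> 0 < `|intv q : 'cV[R]_k|.
Proof.
move=> q0; rewrite normr_gt0; apply: contra_neq q0 => /matrixP q0.
apply/matrixP => i j; have /eqP := q0 i j.
by rewrite !mxE intr_eq0 => /eqP.
Qed.

Lemma finite_intv_ball {R : realType} {k : nat} (N : R) :
  finite_set [set q : 'cV[int]_k | `|intv q : 'cV[R]_k| <= N].
Proof.
have [M NM] : exists M : nat, N <= M%:R.
  exists (Num.bound `|N|); apply: le_trans (ler_norm _) _.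
  by rewrite ltW // archi_boundP.
(* Coordinates in [-M, M] are shifted to [0, 2M]. *)
pose F (f : {ffun 'I_k -> 'I_(M + M).+1}) : 'cV[int]_k :=
  \col_i ((f i)%:Z - M%:Z).
apply: (@sub_finite_set _ _ [set F f | f in setT]); last first.
  exact/finite_image/finite_finset.
move=> q /= qN; exists [ffun i => inord (absz (q i ord0 + M%:Z))] => //.
apply/matrixP => i j; have -> : j = ord0 by exact: ord1.
rewrite !mxE ffunE.
have qM : `|q i ord0 : int| <= M%:Z :> int.
  rewrite -(ler_int R) intr_norm (le_trans _ NM) // (le_trans _ qN) //.
  by have := le_cV_norm (intv q : 'cV[R]_k) i; rewrite mxE.
move: qM; rewrite ler_norml => /andP[qM1 qM2].
rewrite inordK; lia.
Qed.

Lemma finite_pos_lower_bound {R : realType} {T : eqType} (A : set T)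
    (f : T -> R) :
  finite_set A -> (forall a, A a -> 0 < f a) ->
  exists2 d : R, 0 < d & forall a, A a -> d <= f a.
Proof.
move=> /finite_seqP[s ->] /=; elim: s => [|x s IH] f0; first by exists 1.
have [a as_|d d0 df] := IH; first by apply: f0; rewrite /= inE as_ orbT.
exists (Num.min d (f x)); first by rewrite lt_min d0 f0 //= inE eqxx.
move=> a /=; rewrite inE => /predU1P[->|as_]; first by rewrite ge_min lexx orbT.
by rewrite ge_min df.
Qed.

Lemma distZ_le {R : realType} {n : nat} (v : 'cV[R]_n) (p : 'cV[int]_n) :
  distZ v <= `|v - intv p|.
Proof. exact: (distZ_min v).2. Qed.

Lemma distZ_ge0 {R : realType} {n : nat} (v : 'cV[R]_n) : 0 <= distZ v.
Proof. by have [[p ->] _] := distZ_min v. Qed.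

Lemma distZ_gt0 {R : realType} {n : nat} (v : 'cV[R]_n) :
  ~ (exists p : 'cV[int]_n, v = intv p) -> 0 < distZ v.
Proof.
have [[p ->] _] := distZ_min v => vp; rewrite normr_gt0 subr_eq0.
by apply/eqP => vE; apply: vp; exists p.
Qed.

Lemma distZB {R : realType} {n : nat} (u v : 'cV[R]_n) :
  distZ (u - v) <= distZ u + distZ v.
Proof.
have [[p ->] _] := distZ_min u; have [[q ->] _] := distZ_min v.
apply: le_trans (distZ_le _ (p - q)) _; rewrite intvB.
rewrite [X in `|X|](_ : _ = (u - intv p) - (v - intv q)) ?ler_normB //.
by rewrite !opprD !opprK -!addrA; congr (_ + _); rewrite addrCA.
Qed.

(** * Homogeneous approximation *)

(** Pigeonhole: among sufficiently many multiples of one integer vector, two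
    have images whose fractional parts lie in the same box of side [1/K], and
    their difference works. *)
Lemma dirichlet {R : realType} {m n : nat} (m_gt0 : (0 < m)%N)
    (Theta : 'M[R]_(n, m)) (d : R) : 0 < d ->
  exists2 q : 'cV[int]_m, q != 0 & distZ (Theta *m intv q) < d.
Proof.
move=> d0.
pose K := Num.bound d^-1.
have Kd : d^-1 < K%:R by rewrite archi_boundP // invr_ge0 ltW.
have K0 : 0 < K%:R :> R by rewrite (lt_trans _ Kd) // invr_gt0.
pose e : 'cV[int]_m := const_mx 1.
pose w (k : nat) : 'cV[R]_n := Theta *m intv (e *+ k).
pose fr (x : R) := x - (Num.floor x)%:~R.
have fr_itv x : 0 <= fr x < 1.
  by have /andP[] := floor_itv x; rewrite /fr intrD => *; apply/andP; split; lra.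
pose box (k : nat) : {ffun 'I_n -> 'I_K.+1} :=
  [ffun i => inord (Num.trunc (K%:R * fr (w k i ord0)))].
have trunc_fr x : (Num.trunc (K%:R * fr x))%:R <= K%:R * fr x <
    (Num.trunc (K%:R * fr x)).+1%:R.
  by apply: truncn_itv; have /andP[? _] := fr_itv x; rewrite mulr_ge0 // ltW.
have [k [l [kl bkl]]] : exists k l : nat, (k < l)%N /\ box k = box l.
  pose g (i : 'I_(#|{ffun 'I_n -> 'I_K.+1}|.+1)) := box i.
  have /injectivePn[i [j ij gij]] : ~~ injectiveb g.
    by apply/injectiveP => /leq_card; rewrite card_ord ltnn.
  have [lij|lij|/val_inj lij] := ltngtP i j; first by exists i, j.
    by exists j, i.
  by rewrite lij eqxx in ij.
exists (e *+ (l - k)).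
  apply/eqP => /matrixP/(_ (Ordinal m_gt0) ord0).
  rewrite !mulmxnE !mxE => /eqP; lia.
pose p : 'cV[int]_n := \col_i (Num.floor (w l i ord0) - Num.floor (w k i ord0)).
apply: le_lt_trans (distZ_le _ p) _.
have -> : Theta *m intv (e *+ (l - k)) = w l - w k.
  by rewrite mulrnBr ?(ltnW kl) // intvB mulmxBr.
apply: (@le_lt_trans _ _ K%:R^-1); last by rewrite invf_plt // posrE.
apply: cV_norm_le => [|i]; first by rewrite invr_ge0 ltW.
have := congr1 (fun f : {ffun 'I_n -> 'I_K.+1} => (f i : nat)) bkl.
rewrite !ffunE !inordK; last 2 first.
- rewrite ltnS -(ler_nat R); have /andP[+ _] := trunc_fr (w l i ord0).
  by move/le_trans; apply; have /andP[? ?] := fr_itv (w l i ord0); nra.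
- rewrite ltnS -(ler_nat R); have /andP[+ _] := trunc_fr (w k i ord0).
  by move/le_trans; apply; have /andP[? ?] := fr_itv (w k i ord0); nra.
move=> same; have := trunc_fr (w l i ord0); have := trunc_fr (w k i ord0).
rewrite same -natr1 => /andP[k1 k2] /andP[l1 l2].
rewrite !mxE intrB -(ler_pM2l K0) mulfV ?gt_eqF // -{1}(gtr0_norm K0) -normrM.
rewrite [X in `|X|](_ : _ = K%:R * fr (w l i ord0) - K%:R * fr (w k i ord0)).
  by rewrite ler_norml; apply/andP; split; lra.
by rewrite /fr -mulrBr; congr (_ * _); rewrite /w !mxE; lra.
Qed.

Lemma dirichlet_pow {R : realType} {m n : nat} (m_gt0 : (0 < m)%N)
    (n_gt0 : (0 < n)%N) (Theta : 'M[R]_(n, m)) (d c : R) : 0 < d -> 0 < c ->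
  exists q : 'cV[int]_m, [/\ q != 0, distZ (Theta *m intv q) < d &
    distZ (Theta *m intv q) ^+ n <= c].
Proof.
move=> d0 c0; have [|q q0] := dirichlet m_gt0 Theta (Num.min d (Num.min c 1)).
  by rewrite !lt_min d0 c0 ltr01.
rewrite !lt_min => /and3P[qd qc q1]; exists q; split=> //.
by apply: le_trans (ltW qc); rewrite ler_iXnr ?distZ_ge0 // ltW.
Qed.

Lemma distZ_mulmx_gt0 {R : realType} {m n : nat} (Theta : 'M[R]_(n, m))
    (nsing : ~ trivially_singular Theta) (q : 'cV[int]_m) :
  q != 0 -> 0 < distZ (Theta *m intv q).
Proof. by move=> q0; apply: distZ_gt0 => pE; apply: nsing; exists q. Qed.

(** No single vector gives arbitrarily small distances when [Theta] is not
    trivially singular, so infinitely many solutions are needed. *)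
Lemma approximable_of_small {R : realType} {m n : nat} (Theta : 'M[R]_(n, m))
    (nsing : ~ trivially_singular Theta) (F : R -> R) :
  (forall d : R, 0 < d -> exists q : 'cV[int]_m,
    [/\ q != 0, distZ (Theta *m intv q) < d &
      distZ (Theta *m intv q) ^+ n <= F (`|intv q : 'cV[R]_m| ^+ m)]) ->
  approximable F Theta.
Proof.
move=> small fin.
have [q [q0 _]|d d0 dle] :=
  finite_pos_lower_bound _ (fun q => distZ (Theta *m intv q)) fin.
  exact: distZ_mulmx_gt0.
have [q [q0 qd qF]] := small d d0.
by have := dle q (conj q0 qF); rewrite leNgt qd.
Qed.

(** In the first case Dirichlet's pigeonhole alone solves the inequalities with
    right-hand side [h]; in the second, when [h] is non-increasing, it tends to
    [0] and such an inequality at a large argument forces a small distance. *)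
Lemma vanishing_or_bounded {R : realType} (h : R -> R) :
  (exists2 c : R, 0 < c & forall T, 0 < T -> c <= h T) \/
  (forall c : R, 0 < c -> exists2 T, 0 < T & h T < c).
Proof.
have [|nb] := pselect (exists2 c : R, 0 < c & forall T, 0 < T -> c <= h T).
  by left.
right=> c c0; apply: contrapT => nT; apply: nb; exists c => // T T0.
by rewrite leNgt; apply/negP => hT; apply: nT; exists T.
Qed.

(** If [F] tends to [0], long solutions are automatically good; if not,
    Dirichlet's theorem provides solutions that are as good as desired. *)
Lemma small_of_approximable {R : realType} {m n : nat} (m_gt0 : (0 < m)%N)
    (n_gt0 : (0 < n)%N) (Theta : 'M[R]_(n, m)) (F : R -> R)
    (F_noninc : forall S T : R, 0 < S -> S <= T -> F T <= F S) :
  approximable F Theta ->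
  forall d : R, 0 < d -> exists q : 'cV[int]_m,
    [/\ q != 0, distZ (Theta *m intv q) < d &
      distZ (Theta *m intv q) ^+ n <= F (`|intv q : 'cV[R]_m| ^+ m)].
Proof.
move=> inf d d0; have [[c c0 cF]|vanF] := vanishing_or_bounded F.
  have [q [q0 qd qc]] := dirichlet_pow m_gt0 n_gt0 Theta d c d0 c0.
  exists q; split=> //; apply: le_trans qc (cF _ _).
  by rewrite exprn_gt0 // intv_norm_gt0.
have [T T0 FT] := vanF (d ^+ n) (exprn_gt0 n d0).
apply: contrapT => nq; apply: inf.
apply: (sub_finite_set _ (@finite_intv_ball R m (Num.max 1 T))) => q /= [q0 qF].
rewrite leNgt; apply/negP; rewrite gt_max => /andP[q1 qT]; apply: nq; exists q.
split=> //; rewrite -(ltr_pXn2r n_gt0) ?nnegrE ?distZ_ge0 ?(ltW d0) //.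
apply: le_lt_trans qF _; apply: le_lt_trans FT; apply: F_noninc => //.
by rewrite (le_trans (ltW qT)) // ler_eXnr // ltW.
Qed.

(** * From uniform inhomogeneous to homogeneous approximation *)

(** The solution is a difference [q - q'], where [q'] is a shortest vector
    bringing the distance to [eta] below a threshold [c], and [q] is the
    approximation in use just before the length of [q'] is reached. *)
Lemma small_of_hatD {R : realType} {m n : nat} (m_gt0 : (0 < m)%N)
    (n_gt0 : (0 < n)%N) (Theta : 'M[R]_(n, m)) (h : R -> R)
    (h_noninc : forall S T : R, 0 < S -> S <= T -> h T <= h S)
    (eta : 'cV[R]_n) :
  hatD Theta h eta -> ~ trivially_singular_pair Theta eta ->
  forall d : R, 0 < d -> exists q : 'cV[int]_m,
    [/\ q != 0, distZ (Theta *m intv q) < d &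
      distZ (Theta *m intv q) ^+ n <=
        2 ^+ n * h (`|intv q : 'cV[R]_m| ^+ m / 2 ^+ m)].
Proof.
move=> [M [_ etaM]] nsing d d0.
pose dist (q : 'cV[int]_m) := distZ (Theta *m intv q - eta).
have dist_gt0 q : 0 < dist q by apply: distZ_gt0 => pE; apply: nsing; exists q.
have dist0 q : 0 <= dist q := ltW (dist_gt0 q).
have powlt (x y : R) : 0 <= x -> 0 <= y -> x ^+ n < y ^+ n -> x < y.
  by move=> x0 y0; rewrite (ltr_pXn2r n_gt0) // nnegrE.
have [[c c0 ch]|vanh] := vanishing_or_bounded h.
  have [q [q0 qd qc]] := dirichlet_pow m_gt0 n_gt0 Theta d c d0 c0.
  have hq : c <= h (`|intv q : 'cV[R]_m| ^+ m / 2 ^+ m).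
    by apply: ch; rewrite divr_gt0 // exprn_gt0 // intv_norm_gt0.
  exists q; split=> //; apply: le_trans qc _; apply: le_trans (hq) _.
  rewrite ler_peMl ?exprn_ege1 ?ler1n //; exact: le_trans (ltW c0) hq.
have d2 : 0 < d / 2 by lra.
have [T1 T10 hT1] := vanh _ (exprn_gt0 n d2).
have [N1 N1M] : exists N1 : nat, `|M| + T1 + 1 < N1%:R.
  by exists (Num.bound (`|M| + T1 + 1)); rewrite archi_boundP // !addr_ge0 // ltW.
(* A threshold [c] reached only by vectors longer than [N1]. *)
have [c c0 cle] := finite_pos_lower_bound _ dist
  (@finite_intv_ball R m N1%:R) (fun q _ => dist_gt0 q).
have [T2 T20 hT2] := vanh _ (exprn_gt0 n c0).
have exN : exists N : nat, `[< exists q : 'cV[int]_m,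
    [/\ q != 0, `|intv q : 'cV[R]_m| <= N%:R & dist q < c] >].
  have [|q [q0 qh _]] := etaM (`|M| + T2).
    by apply: le_lt_trans (ler_norm M) _; lra.
  have [N qN] := @intv_norm_nat R m q; exists N; apply/asboolP; exists q.
  split; rewrite ?qN //; apply: powlt (ltW c0) _ => //; apply: le_lt_trans qh _.
  by apply: le_lt_trans hT2; apply: h_noninc => //; have := normr_ge0 M; lra.
have [N /asboolP[q' [q'0 q'N q'c]] Nmin] := ex_minnP exN.
have N1N : (N1 < N)%N.
  rewrite ltnNge; apply/negP => NN1.
  suff /cle : `|intv q' : 'cV[R]_m| <= N1%:R by rewrite leNgt q'c.
  by rewrite (le_trans q'N) // ler_nat.
have N1NR : N1%:R + 1 <= N%:R :> R by rewrite natr1 ler_nat.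
have M0 := normr_ge0 M.
(* Norms are integers, so norm at most [N - 1/2] means norm at most [N - 1];
   and [N - 1/2] is half of the largest possible norm [2N - 1] of [q - q']. *)
pose T : R := (N%:R - 2^-1) ^+ m.
have NT : N%:R - 2^-1 <= T by rewrite ler_eXnr //; lra.
have [|q [q0 qh qT]] := etaM T; first by have := ler_norm M; lra.
have {}qT : `|intv q : 'cV[R]_m| <= N%:R - 2^-1.
  by rewrite -(ler_pXn2r m_gt0) ?nnegrE //; lra.
have qN : `|intv q : 'cV[R]_m| + 1 <= N%:R.
  have [k qk] := @intv_norm_nat R m q; move: qT; rewrite qk natr1 ler_nat => kN.
  by rewrite -(ltr_nat R); lra.
have qc : c <= dist q.
  have [k qk] := @intv_norm_nat R m q.
  rewrite leNgt; apply/negP => qc; have : (N <= k)%N.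
    by apply: Nmin; apply/asboolP; exists q; split=> //; rewrite qk.
  by rewrite -(ler_nat R) -qk; lra.
have qq' : distZ (Theta *m intv (q - q')) <= 2 * dist q.
  rewrite intvB mulmxBr.
  rewrite [X in distZ X](_ : _ =
    (Theta *m intv q - eta) - (Theta *m intv q' - eta)).
    by apply: le_trans (distZB _ _) _; rewrite -/(dist q) -/(dist q'); lra.
  by rewrite opprB addrA subrK.
have neq : q - q' != 0.
  by rewrite subr_eq0; apply: contraTneq qc => ->; rewrite -ltNge.
exists (q - q'); split=> //.
  suff : dist q < d / 2 by lra.
  apply: powlt (ltW d2) _ => //; apply: le_lt_trans qh _; apply: le_lt_trans hT1.
  by apply: h_noninc => //; lra.
apply: (@le_trans _ _ ((2 * dist q) ^+ n)).
  by rewrite lerXn2r ?nnegrE ?distZ_ge0 // mulr_ge0.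
rewrite exprMn ler_pM2l ?exprn_gt0 //; apply: le_trans qh _; apply: h_noninc.
  by rewrite divr_gt0 // exprn_gt0 // intv_norm_gt0.
rewrite -expr_div_n lerXn2r ?nnegrE ?divr_ge0 //; first lra.
by rewrite intvB; have := ler_normB (intv q : 'cV[R]_m) (intv q'); lra.
Qed.

(** * A diagonal construction of uniformly approximated points *)

(** In each coordinate, the supremum of the lower ends of nested intervals lies
    in all of them. *)
Lemma nested_balls {R : realType} {n : nat} (s : nat -> 'cV[R]_n) (r : nat -> R) :
  (forall k, 0 < r k) ->
  (forall k, `|s k.+1 - s k| + r k.+1 <= r k) ->
  exists eta : 'cV[R]_n, forall k, `|eta - s k| <= r k.
Proof.
move=> r0 nest.
have far k l : `|s (l + k)%N - s k| + r (l + k)%N <= r k.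
  elim: l => [|l IH]; first by rewrite subrr normr0 add0r.
  rewrite addSn; have := nest (l + k)%N.
  by have := ler_distD (s (l + k)%N) (s (l + k).+1) (s k); lra.
have lower_upper i k l : s k i ord0 - r k <= s l i ord0 + r l.
  have aux a b : `|s (a + b)%N i ord0 - s b i ord0| + r (a + b)%N <= r b.
    apply: le_trans (far b a); rewrite lerD2r.
    by have := le_cV_norm (s (a + b)%N - s b) i; rewrite !mxE.
  have [kl|/ltnW lk] := leqP k l.
    have := aux (l - k)%N k; rewrite subnK //.
    have := ler_norm (s k i ord0 - s l i ord0); rewrite distrC.
    by have := r0 l; have := r0 k; lra.
  have := aux (k - l)%N l; rewrite subnK //.
  have := ler_norm (s k i ord0 - s l i ord0).
  by have := r0 l; have := r0 k; lra.
pose E i := range (fun k => s k i ord0 - r k).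
exists (\col_i sup (E i)) => k; apply: cV_norm_le => [|i]; first exact: ltW.
rewrite !mxE.
have lo : s k i ord0 - r k <= sup (E i).
  apply: ub_le_sup; last by exists k.
  by exists (s 0%N i ord0 + r 0%N) => _ [l _ <-].
have up : sup (E i) <= s k i ord0 + r k.
  by apply: ge_sup; [exists (s 0%N i ord0 - r 0%N), 0%N | move=> _ [l _ <-]].
by rewrite ler_norml; apply/andP; split; lra.
Qed.

(** A triple [(Q, P, r)] encodes the closed ball of radius [r] around the point
    [Theta *m intv Q - intv P], which [Q] approximates exactly. *)
Definition center {R : realType} {m n : nat} (Theta : 'M[R]_(n, m))
    (x : 'cV[int]_m * 'cV[int]_n * R) : 'cV[R]_n :=
  Theta *m intv x.1.1 - intv x.1.2.

(** One step of the diagonal construction. The last clause bounds the distance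
    from the center of [x] to any point of [y]: it makes the vector of [x] a good
    enough approximation of such a point until the vector of [y] takes over. *)
Definition refinement {R : realType} {m n : nat} (Theta : 'M[R]_(n, m))
    (h : R -> R) (e : 'cV[R]_n) (x y : 'cV[int]_m * 'cV[int]_n * R) : Prop :=
  [/\ 0 < y.2,
      `|center Theta y - center Theta x| + y.2 <= x.2,
      y.2 < `|center Theta y - e|,
      `|intv x.1.1 : 'cV[R]_m| + 1 <= `|intv y.1.1 : 'cV[R]_m| &
      (`|center Theta y - center Theta x| + y.2) ^+ n <=
        h (`|intv y.1.1 : 'cV[R]_m| ^+ m)].

(** The new center is the old one plus [v] or [2 v], where [v] is the error of a
    long and good approximation [q]. With radius [`|v| / 3] the two candidate
    balls are disjoint, so one of them avoids [e]. *)
Lemma ball_refinement {R : realType} {m n : nat} (Theta : 'M[R]_(n, m))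
    (nsing : ~ trivially_singular Theta) (h : R -> R)
    (h_noninc : forall S T : R, 0 < S -> S <= T -> h T <= h S) :
  (forall d : R, 0 < d -> exists q : 'cV[int]_m,
    [/\ q != 0, distZ (Theta *m intv q) < d &
      (3 * distZ (Theta *m intv q)) ^+ n <= h ((3 * `|intv q : 'cV[R]_m|) ^+ m)]) ->
  forall (e : 'cV[R]_n) (x : 'cV[int]_m * 'cV[int]_n * R), 0 < x.2 ->
  exists y : 'cV[int]_m * 'cV[int]_n * R, refinement Theta h e x y.
Proof.
move=> small e [[Q P] r] /= r0.
(* Vectors too short to make the new [Q] longer than the old one; a distance
   below the bound [d] excludes them. *)
pose bad := [set q : 'cV[int]_m | q != 0 /\
  `|intv q : 'cV[R]_m| <= 2 * `|intv Q : 'cV[R]_m| + 1].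
have fbad : finite_set bad.
  by apply: (sub_finite_set _ (finite_intv_ball _)) => q [_]; exact.
have [q [q0 _]|d d0 dbad] :=
  finite_pos_lower_bound _ (fun q => distZ (Theta *m intv q)) fbad.
  exact: distZ_mulmx_gt0.
(* With [z] the distance of [q], the new ball reaches at most [2z + z/3] away
   from the old center; [z < r/3] keeps it inside the old ball. *)
have [|q [q0]] := small (Num.min d (r / 3)); first by rewrite lt_min d0; lra.
rewrite lt_min => /andP[qd qr] qh.
have z0 := distZ_mulmx_gt0 Theta nsing q q0.
have qQ : 2 * `|intv Q : 'cV[R]_m| + 1 < `|intv q : 'cV[R]_m|.
  rewrite ltNge; apply/negP => qQ.
  by have := dbad q (conj q0 qQ); rewrite leNgt qd.
have [[p zE] _] := distZ_min (Theta *m intv q).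
set z := distZ _ in qd qr qh z0 zE; pose v := Theta *m intv q - intv p.
have vz : `|v| = z by [].
pose y (j : nat) := (Q + q *+ j, P + p *+ j, z / 3).
have cy j : center Theta (y j) = center Theta (Q, P, r) + v *+ j.
  by rewrite /center /= !intvD !intvMn mulmxDr raddfMn /= opprD addrACA -mulrnBl.
have [j [j0 j3 je]] : exists j : nat,
    [/\ (0 < j)%N, (j < 3)%N & z / 3 < `|center Theta (y j) - e|].
  have [far1|near1] := ltP (z / 3) `|center Theta (y 1%N) - e|; first by exists 1%N.
  exists 2%N; split=> //; rewrite ltNge; apply/negP => near2.
  have := ler_distD e (center Theta (y 2%N)) (center Theta (y 1%N)).
  rewrite (distrC e); have -> : center Theta (y 2%N) - center Theta (y 1%N) = v.
    by rewrite !cy opprD addrACA subrr add0r mulr2n addrK.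
  by rewrite vz; lra.
have jlo : 1 <= j%:R :> R by rewrite ler1n.
have jup : j%:R <= 2 :> R by rewrite ler_nat.
have qj : `|intv (q *+ j) : 'cV[R]_m| = j%:R * `|intv q : 'cV[R]_m|.
  by rewrite intvMn normrMn mulr_natl.
have Q0 := normr_ge0 (intv Q : 'cV[R]_m).
have Qlo : `|intv Q : 'cV[R]_m| + 1 <= `|intv (Q + q *+ j) : 'cV[R]_m|.
  have := ler_normB (intv (Q + q *+ j) : 'cV[R]_m) (intv Q).
  rewrite -intvB addrC addKr qj; nra.
have Qup : `|intv (Q + q *+ j) : 'cV[R]_m| <= 3 * `|intv q : 'cV[R]_m|.
  rewrite intvD; have := ler_normD (intv Q : 'cV[R]_m) (intv (q *+ j)).
  rewrite qj; nra.
have yx : `|center Theta (y j) - center Theta (Q, P, r)| = j%:R * z.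
  by rewrite cy addrC addKr normrMn vz mulr_natl.
exists (y j); rewrite /refinement yx /=; split=> //; [lra|nra|].
apply: (@le_trans _ _ ((3 * z) ^+ n)); first by rewrite lerXn2r ?nnegrE //; nra.
apply: le_trans qh _; apply: h_noninc; first by rewrite exprn_gt0; lra.
by rewrite lerXn2r ?nnegrE //; lra.
Qed.

(** Cantor's argument: refining balls so that the [k]-th step avoids the [k]-th
    point of an enumeration yields a common point that is not enumerated. It
    lies in [hatD Theta h]: for a given [T], the last vector of size at most [T]
    serves, since the next one is longer than [T] allows. *)
Lemma hatD_uncountable {R : realType} {m n : nat} (m_gt0 : (0 < m)%N)
    (Theta : 'M[R]_(n, m))
    (nsing : ~ trivially_singular Theta) (h : R -> R)
    (h_noninc : forall S T : R, 0 < S -> S <= T -> h T <= h S) :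
  (forall d : R, 0 < d -> exists q : 'cV[int]_m,
    [/\ q != 0, distZ (Theta *m intv q) < d &
      (3 * distZ (Theta *m intv q)) ^+ n <= h ((3 * `|intv q : 'cV[R]_m|) ^+ m)]) ->
  ~ countable (hatD Theta h).
Proof.
move=> small /countable_injP[f finj].
pose e k := xget 0 [set eta | hatD Theta h eta /\ f eta = k].
have eE eta : hatD Theta h eta -> e (f eta) = eta.
  move=> Deta; have [D' f'] : hatD Theta h (e (f eta)) /\ f (e (f eta)) = f eta.
    exact: (xgetPex 0 (ex_intro (fun z => hatD Theta h z /\ f z = f eta)
      eta (conj Deta erefl))).
  by apply: finj; rewrite ?inE.
have stepP (ex : 'cV[R]_n * ('cV[int]_m * 'cV[int]_n * R)) :
    exists y, 0 < ex.2.2 -> refinement Theta h ex.1 ex.2 y.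
  have [x0|nx0] := pselect (0 < ex.2.2); last by exists ex.2.
  have [y Hy] := ball_refinement Theta nsing h h_noninc small ex.1 ex.2 x0.
  by exists y.
have [F FP] := choice stepP.
pose x := fix x k := if k is l.+1 then F (e l, x l) else (0, 0, 1).
have x_gt0 k : 0 < (x k).2 by elim: k => [|k IH] //=; have [] := FP (e k, x k) IH.
have xP k := FP (e k, x k) (x_gt0 k).
pose Q k : 'cV[R]_m := intv (x k).1.1.
have Qk k : k%:R <= `|Q k|.
  elim: k => // k IH; have [_ _ _ + _] := xP k.
  by rewrite -natr1; apply: le_trans; rewrite lerD2r.
have [eta etaP] : exists eta, forall k, `|eta - center Theta (x k)| <= (x k).2.
  by apply: nested_balls => // k; have [] := xP k.
suff /eE eta_e : hatD Theta h eta.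
  have [_ _ far _ _] := xP (f eta); have near := etaP (f eta).+1.
  by have := le_lt_trans near far; rewrite /= eta_e distrC ltxx.
exists (`|Q 1%N| ^+ m); split=> [|T QT]; first by rewrite realE exprn_ge0.
have exk : exists k, T < `|Q k.+1| ^+ m.
  have T0 : 0 <= T by apply: le_trans (ltW QT); rewrite exprn_ge0.
  exists (Num.bound T); apply: lt_le_trans (archi_boundP T0) _.
  have le1 : (Num.bound T)%:R <= `|Q (Num.bound T).+1|.
    by apply: le_trans (Qk _); rewrite ler_nat.
  apply: le_trans le1 _; rewrite ler_eXnr //; apply: le_trans (Qk _).
  by rewrite ler1n.
(* Index [0] carries the zero vector; [T] is beyond the size of the first
   vector, so the index found is positive. *)
have [[|k] Tk kmin] := ex_minnP exk; first by rewrite ltNge ltW in Tk.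
have QkT : `|Q k.+1| ^+ m <= T.
  by rewrite leNgt; apply/negP => /kmin; rewrite ltnn.
have Qk0 : (0 : R) < `|Q k.+1| by rewrite (lt_le_trans _ (Qk _)) // ltr0n.
exists (x k.+1).1.1; split=> //.
  by apply: contraTneq Qk0 => q0; rewrite /Q q0 intv0 normr0 ltxx.
have [_ _ _ _ yh] := xP k.+1.
apply: (@le_trans _ _ (h (`|Q k.+2| ^+ m))); last first.
  by apply: h_noninc; [rewrite (lt_le_trans _ QkT) // exprn_gt0 | exact: ltW].
apply: le_trans yh.
rewrite lerXn2r ?nnegrE ?distZ_ge0 ?addr_ge0 // ?(ltW (x_gt0 k.+2)) //.
apply: le_trans (distZ_le _ (x k.+1).1.2) _.
rewrite addrAC -/(center Theta (x k.+1)).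
have := ler_distD (center Theta (x k.+2)) (center Theta (x k.+1)) eta.
move=> /le_trans; apply.
by rewrite lerD // 1?distrC ?etaP // distrC.
Qed.

(** * Transference from homogeneous to uniform inhomogeneous approximation *)

Theorem theorem3p8 (R : realType) (m n : nat) (m_gt0 : (0 < m)%N)
    (n_gt0 : (0 < n)%N) (Theta : 'M[R]_(n, m))
    (Theta_nsing : ~ trivially_singular Theta)
    (eps : R) (eps_gt0 : 0 < eps)
    (h : R -> R) (h_gt0 : forall T : R, 0 < T -> 0 < h T)
    (h_noninc : forall S T : R, 0 < S -> S <= T -> h T <= h S) :
  (let F := fun T : R => (1 + eps) * 2 ^+ n * h (T / 2 ^+ m) in
   ~ approximable F Theta ->
   ~ (exists eta : 'cV[R]_n,
        hatD Theta h eta /\ ~ trivially_singular_pair Theta eta))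
  /\
  (let A : R := 3 ^+ (n + m) - 1 in
   let B : R := 2 ^+ (m - 1) * (2 ^+ (2 * n) - 2 ^+ n) in
   let F := fun T : R =>
     (1 - eps) / (2 ^+ n * B ^+ n) * h (2 ^+ m * A ^+ m * T) in
   approximable F Theta -> ~ countable (hatD Theta h)).
Proof.
split=> [F napprox [eta [Deta nsing]]|A B F approx].
  apply: napprox; apply: (approximable_of_small Theta Theta_nsing) => d d0.
  have [q [q0 qd qh]] :=
    small_of_hatD m_gt0 n_gt0 Theta h h_noninc eta Deta nsing d d0.
  exists q; split=> //; apply: le_trans qh _.
  rewrite /F -mulrA ler_peMl //; last by lra.
  rewrite mulr_ge0 ?exprn_ge0 // ltW // h_gt0 // divr_gt0 ?exprn_gt0 //.
  exact: intv_norm_gt0.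
have A8 : 8 <= A.
  have : 3 ^+ 2 <= 3 ^+ (n + m) :> R by rewrite ler_weXn2l ?ler1n //; lia.
  by rewrite /A expr2; lra.
have B2 : 2 <= B.
  have m1 : 1 <= 2 ^+ (m - 1) :> R by rewrite exprn_ege1 // ler1n.
  have n1 : 2 <= 2 ^+ n :> R by rewrite ler_eXnr // ler1n.
  rewrite /B mulnC exprM expr2.
  set b := 2 ^+ n in n1 *; have b2 : 2 <= b * b - b by nra.
  by rewrite -[leLHS]mul1r ler_pM.
have c0 : 0 < 2 ^+ n * B ^+ n by rewrite mulr_gt0 // exprn_gt0 //; lra.
have hF T : 0 < T -> 0 < h (2 ^+ m * A ^+ m * T).
  by move=> T0; apply: h_gt0; rewrite !mulr_gt0 ?exprn_gt0 //; lra.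
(* Otherwise the bound is nonpositive, whereas all distances are positive. *)
have eps1 : eps < 1.
  rewrite ltNge; apply/negP => eps1.
  have [q [q0]] := infinite_setN0 approx; apply/negP; rewrite -ltNge.
  apply: (@le_lt_trans _ _ 0); last by rewrite exprn_gt0 // distZ_mulmx_gt0.
  rewrite /F mulr_le0_ge0 //; last by rewrite ltW // hF // exprn_gt0 // intv_norm_gt0.
  by rewrite mulr_le0_ge0 ?invr_ge0 ?(ltW c0) //; lra.
have Fc0 : 0 <= (1 - eps) / (2 ^+ n * B ^+ n) by rewrite divr_ge0 ?(ltW c0) //; lra.
apply: hatD_uncountable => // d d0.
have [S T S0 ST|q [q0 qd qF]] :=
  small_of_approximable m_gt0 n_gt0 Theta F _ approx d d0.
  rewrite /F ler_wpM2l // h_noninc //; first by rewrite !mulr_gt0 ?exprn_gt0 //; lra.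
  by rewrite ler_wpM2l // mulr_ge0 // exprn_ge0 //; lra.
exists q; split=> //.
have qn0 : 0 < `|intv q : 'cV[R]_m| by exact: intv_norm_gt0.
apply: (@le_trans _ _ (h (2 ^+ m * A ^+ m * `|intv q : 'cV[R]_m| ^+ m))); last first.
  apply: h_noninc; first by rewrite exprn_gt0 // mulr_gt0.
  by rewrite -!exprMn lerXn2r ?nnegrE //; nra.
apply: (@le_trans _ _ (2 ^+ n * B ^+ n * distZ (Theta *m intv q) ^+ n)).
  rewrite -!exprMn; have := distZ_ge0 (Theta *m intv q) => z0.
  by rewrite lerXn2r ?nnegrE //; nra.
rewrite -ler_pdivlMl //; apply: le_trans qF _.
rewrite /F -mulrA mulrCA ler_pM2l ?invr_gt0 //.
by rewrite ler_piMl ?(ltW (hF _ _)) ?exprn_gt0 //; lra.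
Qed.
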